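(* Let $(M,g)$ be a Riemannian manifold (finite- or infinite-dimensional), let $A^1,\dots,A^d$ be $(1,1)$-tensor fields on $M$ and $Q$ a tangent vector field on $M$, and consider the first-order equation $\frac{\partial u}{\partial t}+\sum_{j=1}^d A^j\frac{\partial u}{\partial x^j}=Q|_u$ for $u=u(t,\boldsymbol{x})\in M$. Let $i:\hat M\to M$ be an embedded submanifold, $\hat g:=i^*g$, and let $p:M\to\hat M$ be a smooth map with $p\circ i=\mathrm{id}_{\hat M}$. Suppose that $i_*$ and $p_*$ are mutually adjoint, i.e. $$\hat g(p_*X,\hat Y)|_{\hat u}=g(X,i_*\hat Y)|_{i(\hat u)}$$ for each $\hat u\in\hat M$, $X\in\Gamma(TM)$ and $\hat Y\in\Gamma(T\hat M)$. Then the model reduction preserves hyperbolicity: if the original equation is hyperbolic with respect to $g$, then the reduced model $$\frac{\partial\hat u}{\partial t}+\sum_{j=1}^d\hat A^j\frac{\partial\hat u}{\partial x^j}=\hat Q|_{\hat u},\qquad \hat A^j:=p_*\circ A^j\circ i_*,\quad \hat Q:=p_*\circ Q\circ i,$$ on $\hat M$ is hyperbolic with respect to $\hat g$.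
   Context: A $(1,1)$-tensor field $A^j$ on $M$ is regarded as a fibrewise linear map $TM\to TM$ over the identity. $\Gamma(TM)$ denotes the smooth tangent vector fields. $i_*,p_*$ are the pushforwards (differentials) of $i,p$; $p_*$ is applied at points $i(\hat u)$, giving $p_*:T_{i(\hat u)}M\to T_{\hat u}\hat M$. Hyperbolicity: the equation $\partial_t u+\sum_j A^j\partial_{x^j}u=Q|_u$ on $(M,g)$ is called hyperbolic with respect to the Riemannian metric $g$ if $g(A^jX,Y)=g(X,A^jY)$ for all $X,Y\in\Gamma(TM)$ and all $j=1,\dots,d$. Convention: if $T_uM$ is a Hilbert space and $A^j|_u$ is only densely defined, identities involving $A^jX$ are understood for $X|_u$ in the domain $D(A^j|_u)$; in that case it is always assumed that $i_*T_{\hat u}\hat M$ is closed in $T_{i(\hat u)}M$ and that $(i_* )^{-1}(D(A^j|_{i(\hat u)})\cap i_*T_{\hat u}\hat M)$, the domain of $\hat A^j|_{\hat u}$, is dense in $T_{\hat u}\hat M$. *)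

(* Defs.v *)
From HB Require Import structures.
From mathcomp Require Import all_boot all_order all_algebra.
From mathcomp Require Import all_classical all_reals all_analysis.

Set Implicit Arguments.
Unset Strict Implicit.
Unset Printing Implicit Defensive.

Import Order.TTheory GRing.Theory Num.Theory.
Import numFieldNormedType.Exports.

Local Open Scope classical_set_scope.
Local Open Scope ring_scope.

(* The derivative of order one is the map (x, v) |-> 'd f x v on U * E, and
   [Ck_on n.+1] asks this map to be [Ck_on n].  For finite n this is slightly
   weaker than n-fold continuous Frechet differentiability (the derivative is
   continuous in (x, v), not in operator norm), but C^(n+1) in this sense
   implies C^n in the sense of Frechet, so that [smooth_on] is the usual
   notion of C^infinity map on the open set U. *)
Fixpoint Ck_on (R : realType) (n : nat) (E F : normedModType R)
    (U : set E) (f : E -> F) : Prop :=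
  match n with
  | 0 => forall x, U x -> {for x, continuous f}
  | m.+1 => (forall x, U x -> differentiable f x) /\
            Ck_on m (U `*` [set: E])
                    (fun z : (E * E)%type => 'd f (z.1) z.2)
  end.

Definition smooth_on (R : realType) (E F : normedModType R)
    (U : set E) (f : E -> F) : Prop := forall n, Ck_on n U f.

Record inner_product (R : realType) (V : lmodType R) (b : V -> V -> R) :
    Prop := {
  ip_linear : forall z, scalar (b^~ z) ;
  ip_sym : forall x y, b x y = b y x ;
  ip_pos : forall x, x != 0 -> 0 < b x x }.

(* The norm of E is only required to be equivalent to a Hilbert norm: the norm
   of 'rV[R]_n, for instance, is the maximum norm. *)
Definition hilbertable (R : realType) (E : completeNormedModType R) : Prop :=
  exists b : E -> E -> R, inner_product b /\
    exists c C : R, [/\ 0 < c, 0 < C &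
      forall x, c * `|x| ^+ 2 <= b x x <= C * `|x| ^+ 2].

(* A homeomorphism from the open set [ch_dom c] of T onto an open set of E;
   [ch_fun] and [ch_inv] are meaningless outside of these sets. *)
Record chart (R : realType) (E : completeNormedModType R)
    (T : topologicalType) := Chart {
  ch_dom : set T ;
  ch_fun :> T -> E ;
  ch_inv : E -> T ;
  ch_dom_open : open ch_dom ;
  ch_cod_open : open (ch_fun @` ch_dom) ;
  ch_funK : forall u, ch_dom u -> ch_inv (ch_fun u) = u ;
  ch_fun_continuous : forall u, ch_dom u -> {for u, continuous ch_fun} ;
  ch_inv_continuous :
    forall x, (ch_fun @` ch_dom) x -> {for x, continuous ch_inv} }.

Definition ch_cod (R : realType) (E : completeNormedModType R)
    (T : topologicalType) (c : chart E T) : set E := c @` ch_dom c.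

(* [chart_at u] is a chosen chart around u; it only serves to coordinatize the
   tangent space at u.  Regularity of the topology is automatic for Hausdorff
   manifolds that are finite-dimensional, paracompact, or that carry a
   Riemannian metric inducing the Hilbert topology on each tangent space. *)
Record manifold (R : realType) (E : completeNormedModType R) := Manifold {
  carrier :> topologicalType ;
  atlas : set (chart E carrier) ;
  chart_at : carrier -> chart E carrier ;
  model_hilbertable : hilbertable E ;
  carrier_hausdorff : hausdorff_space carrier ;
  carrier_regular : regular_space carrier ;
  atlas_compatible : forall c c', atlas c -> atlas c' ->
    smooth_on (c @` (ch_dom c `&` ch_dom c')) (c' \o ch_inv c) ;
  atlas_chart_at : forall u, atlas (chart_at u) ;
  mem_chart_at : forall u, ch_dom (chart_at u) u }.

(* A tangent vector at u is represented by its coordinates in [chart_at u];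
   equal base points thus have convertible tangent spaces, with the same
   coordinates. *)
Definition Tan (R : realType) (E : completeNormedModType R) (M : manifold E)
  (u : M) : completeNormedModType R := E.

Section Manifold.
Variables (R : realType) (E : completeNormedModType R) (M : manifold E).

Definition to_chart (c : chart E M) (u : M) (v : Tan u) : E :=
  'd (c \o ch_inv (chart_at u)) (chart_at u u) v.

Definition of_chart (c : chart E M) (u : M) (v : E) : Tan u :=
  'd (chart_at u \o ch_inv c) (c u) v.

(* [smooth_field X] states that X belongs to Gamma(TM). *)
Definition smooth_field (X : forall u : M, Tan u) : Prop :=
  forall c, atlas c ->
    smooth_on (ch_cod c) (fun x => to_chart c (X (ch_inv c x))).

Definition form_field := forall u : M, Tan u -> Tan u -> R.

(* The inner products are not required to be complete: strong as well as weak
   Riemannian metrics are allowed. *)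
Definition riemannian_metric (g : form_field) : Prop :=
  (forall u, inner_product (g u)) /\
  forall c, atlas c ->
    smooth_on [set z : (E * (E * E))%type | ch_cod c z.1]
      (fun z => g (ch_inv c z.1) (of_chart c (ch_inv c z.1) z.2.1)
                                 (of_chart c (ch_inv c z.1) z.2.2) : R^o).

(* A field of linear operators on the tangent spaces, the operator at u being
   defined on the linear subspace [op_dom A u]; [op_fun A u] is meaningless
   outside of it.  A (1,1)-tensor field is the case where [op_dom A u] is the
   whole tangent space. *)
Unset Implicit Arguments.
Record operator_field := OperatorField {
  op_dom : forall u : M, set (Tan u) ;
  op_fun :> forall u : M, Tan u -> Tan u ;
  op_dom0 : forall u, op_dom u 0 ;
  op_domP : forall u (a : R) (X Y : Tan u),
    op_dom u X -> op_dom u Y -> op_dom u (a *: X + Y) ;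
  op_linear : forall u (a : R) (X Y : Tan u), op_dom u X -> op_dom u Y ->
    op_fun u (a *: X + Y) = a *: op_fun u X + op_fun u Y }.
Set Implicit Arguments.

Definition densely_defined (A : operator_field) : Prop :=
  forall u, dense (op_dom A u).

(* The equation d_t u + \sum_(j < d) A^j d_(x^j) u = Q(u), given by its
   coefficients A^j = [flux j] and Q = [source]. *)
Record first_order_system (d : nat) := FirstOrderSystem {
  flux : 'I_d -> operator_field ;
  source : forall u : M, Tan u }.

Definition hyperbolic (d : nat) (g : form_field) (S : first_order_system d) :
    Prop :=
  forall X Y : (forall u : M, Tan u), smooth_field X -> smooth_field Y ->
  forall (j : 'I_d) (u : M),
    op_dom (flux S j) u (X u) -> op_dom (flux S j) u (Y u) ->
    g u (flux S j u (X u)) (Y u) = g u (X u) (flux S j u (Y u)).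

End Manifold.

Arguments operator_field {R E} M.
Arguments op_dom {R E M} A u _ : rename.
Arguments op_fun {R E M} A u _ : rename.

Section Maps.
Variables (R : realType) (E F : completeNormedModType R).
Variables (M : manifold E) (N : manifold F).

Definition smooth_map (f : M -> N) : Prop :=
  continuous f /\
  forall c c', atlas c -> atlas c' ->
    smooth_on (c @` (ch_dom c `&` f @^-1` ch_dom c')) (c' \o f \o ch_inv c).

Definition tangent_map (f : M -> N) (u : M) (v : Tan u) : Tan (f u) :=
  'd (chart_at (f u) \o f \o ch_inv (chart_at u)) (chart_at u u) v.

(* A smooth immersion that is a homeomorphism onto its image.  In a Hilbert
   space, closed subspaces are complemented, so the range of the differential
   splits. *)
Definition embedding (f : M -> N) : Prop :=
  [/\ smooth_map f,
      injective f,
      (forall U : set M, open U -> exists2 V : set N, open V & f @^-1` V = U) &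
      forall u, injective (@tangent_map f u) /\
                closed (range (@tangent_map f u))].

Definition pullback (f : M -> N) (g : form_field N) : form_field M :=
  fun u X Y => g (f u) (tangent_map f X) (tangent_map f Y).

End Maps.

Section Reduction.
Variables (R : realType) (E Eh : completeNormedModType R).
Variables (M : manifold E) (Mh : manifold Eh) (i : Mh -> M) (p : M -> Mh).

(* The differential of p at i u, as a map into T_u Mh; it is meant for maps p
   such that p (i u) = u. *)
Definition retract_push (u : Mh) (X : Tan (i u)) : Tan u := tangent_map p X.

Definition adjoint_push (g : form_field M) : Prop :=
  forall (u : Mh) (X : forall w : M, Tan w) (Y : forall w : Mh, Tan w),
    smooth_field X -> smooth_field Y ->
    pullback i g (retract_push (X (i u))) (Y u)
    = g (i u) (X (i u)) (tangent_map i (Y u)).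

Definition reduced_dom (A : operator_field M) (u : Mh) : set (Tan u) :=
  @tangent_map R Eh E Mh M i u @^-1` op_dom A (i u).

Definition reduced_fun (A : operator_field M) (u : Mh) (X : Tan u) : Tan u :=
  retract_push (A (i u) (tangent_map i X)).

Lemma reduced_dom0 (A : operator_field M) u : reduced_dom A (0 : Tan u).
Proof.
rewrite /reduced_dom /preimage /= /tangent_map linear0; exact: op_dom0.
Qed.

Lemma reduced_domP (A : operator_field M) u (a : R) (X Y : Tan u) :
  reduced_dom A X -> reduced_dom A Y -> reduced_dom A (a *: X + Y).
Proof.
rewrite /reduced_dom /preimage /= /tangent_map linearP; exact: op_domP.
Qed.

Lemma reduced_linear (A : operator_field M) u (a : R) (X Y : Tan u) :
  reduced_dom A X -> reduced_dom A Y ->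
  reduced_fun A (a *: X + Y) = a *: reduced_fun A X + reduced_fun A Y.
Proof.
move=> AX AY; rewrite /reduced_fun /retract_push.
have -> : tangent_map i (a *: X + Y)
          = a *: tangent_map i X + tangent_map i Y by exact: linearP.
by rewrite op_linear//; exact: linearP.
Qed.

Definition reduced_op (A : operator_field M) : operator_field Mh :=
  {| op_dom := @reduced_dom A; op_fun := @reduced_fun A;
     op_dom0 := @reduced_dom0 A; op_domP := @reduced_domP A;
     op_linear := @reduced_linear A |}.

Definition reduced_system (d : nat) (S : first_order_system M d) :
    first_order_system Mh d :=
  {| flux := fun j => reduced_op (flux S j);
     source := fun u => retract_push (source S (i u)) |}.

(* Standing assumption at the points of i(Mh) where A is not defined on the
   whole tangent space. *)
Definition reducible (A : operator_field M) : Prop :=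
  forall u : Mh, op_dom A (i u) != [set: Tan (i u)] ->
    closed (range (@tangent_map R Eh E Mh M i u)) /\
    dense (op_dom (reduced_op A) u).

End Reduction.

(* Main.v *)
(** If u is a point of the submanifold, then adjointness of i_* and p_* gives
    g^(p_* A i_* X, Y) = g(A i_* X, i_* Y) at u, and symmetry of A turns the
    right-hand side into g(i_* X, A i_* Y) = g^(X, p_* A i_* Y).  Both hypotheses
    speak of values of smooth vector fields on M, while i_* X and A i_* X are
    single tangent vectors at i u; hence every tangent vector has to be extended
    to a smooth field, which uses a bump function: a squared Hilbert norm composed
    with a function built from exp (- 1 / s). *)
Require Import Defs.
From HB Require Import structures.
From mathcomp Require Import all_boot all_order all_algebra.
From mathcomp Require Import all_classical all_reals all_analysis.
From mathcomp Require Import ring lra.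

Set Implicit Arguments.
Unset Strict Implicit.
Unset Printing Implicit Defensive.

Import Order.TTheory GRing.Theory Num.Theory.
Import numFieldNormedType.Exports.

Local Open Scope classical_set_scope.
Local Open Scope ring_scope.

(** * Calculus of C^n maps between normed spaces *)

Section CkCalculus.
Variable R : realType.
Implicit Types E F G : normedModType R.

Lemma open_setXT (S T : topologicalType) (U : set S) :
  open U -> open (U `*` [set: T]).
Proof.
move=> oU; have -> : U `*` [set: T] = fst @^-1` U.
  by apply/seteqP; split=> [x []|x Ux].
by apply: open_comp oU => x _; exact: cvg_fst.
Qed.

(** The first-order expansion of [f] at [x] is also one of [g], and a continuous linear map
    occurring in such an expansion is the differential. *)
Lemma near_eq_is_diff E F (f g : E -> F) x :
  (\forall y \near x, f y = g y) -> differentiable f x ->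
  is_diff x g ('d f x).
Proof.
move=> fg df.
have eg : g \o shift x = cst (g x) + 'd f x +o_ 0 id.
  apply/eqaddoP => e e0.
  have /eqaddoP/(_ e e0) := diff_locally df.
  have fg0 : \forall h \near (0 : E), f (h + x) = g (h + x).
    by move/nbhs0P: fg; apply: filterS => h; rewrite addrC.
  apply: filterS2 fg0 => h fgh.
  have fgx : f x = g x by exact: nbhs_singleton fg.
  by rewrite !fctE /= fgh fgx.
have dE : 'd g x = 'd f x :> (E -> F).
  by apply: diff_unique => //; exact: diff_continuous.
apply: DiffDef => //; apply/diff_locallyP; rewrite dE; split => //.
exact: diff_continuous.
Qed.

(** On an open set, agreement on [U] is agreement near each point of [U], so the differentials agree
    on [U * E], which is open again. *)
Lemma Ck_on_eq n E F (U : set E) (f g : E -> F) : open U ->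
  {in U, f =1 g} -> Ck_on n U f -> Ck_on n U g.
Proof.
elim: n E F U f g => [|n IH] E F U f g oU fg /=.
  move=> cf x Ux; rewrite /prop_for /continuous_at -(fg x) ?inE//.
  apply: cvg_trans (cf x Ux); apply: near_eq_cvg.
  by near=> y; apply: fg; rewrite inE; near: y; exact: open_nbhs_nbhs.
have nfg x : U x -> \forall y \near x, f y = g y.
  by move=> Ux; near=> y; apply: fg; rewrite inE; near: y; exact: open_nbhs_nbhs.
move=> [df Cf]; split=> [x Ux|].
  by have [] := near_eq_is_diff (nfg x Ux) (df x Ux).
apply: IH Cf; first exact: open_setXT.
move=> [x v]; rewrite inE => -[/= Ux _].
by have [_ ->] := near_eq_is_diff (nfg x Ux) (df x Ux).
Unshelve. all: by end_near. Qed.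

Lemma Ck_on_subset n E F (U V : set E) (f : E -> F) :
  U `<=` V -> Ck_on n V f -> Ck_on n U f.
Proof.
elim: n E F U V f => [|n IH] E F U V f UV /=; first by move=> cf x /UV/cf.
move=> [df Cf]; split=> [x /UV/df//|]; apply: IH Cf.
by apply: setSX.
Qed.

(** Every condition in [Ck_on] is imposed point by point, so no compatibility is to be checked. This
    allows a field to be treated separately on the two pieces of a cover. *)
Lemma Ck_onU n E F (U V : set E) (f : E -> F) :
  Ck_on n U f -> Ck_on n V f -> Ck_on n (U `|` V) f.
Proof.
elim: n E F U V f => [|n IH] E F U V f /=.
  by move=> cU cV x [/cU|/cV].
move=> [dU CU] [dV CV]; split=> [x [/dU|/dV]//|].
by apply: (Ck_on_subset _ (IH _ _ _ _ _ CU CV)) => -[x v] /= [[Ux|Vx] _]; [left|right].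
Qed.

Lemma Ck_onW n E F (U : set E) (f : E -> F) : Ck_on n.+1 U f -> Ck_on n U f.
Proof.
elim: n E F U f => [|n IH] E F U f [df Cf].
  by move=> x /df /differentiable_continuous.
by split=> //; exact: IH.
Qed.

(** The derivative map is [f] after the second projection, which is again linear and continuous, so
    the induction closes. *)
Lemma Ck_on_linear n E F (U : set E) (f : E -> F) :
  linear f -> continuous f -> Ck_on n U f.
Proof.
elim: n E F U f => [|n IH] E F U f lf cf; first by move=> x _; exact: cf.
pose fL : {linear E -> F} := HB.pack f (GRing.isLinear.Build _ _ _ _ _ lf).
have dE x : 'd f x = f :> (E -> F) by exact: (@diff_lin _ _ _ fL).
split=> [x _|]; first exact: (@linear_differentiable _ _ _ fL).
have -> : (fun z : E * E => 'd f (z.1) z.2) = (fun z : E * E => f z.2).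
  by apply/funext => z; rewrite dE.
apply: IH; first by move=> a x y; rewrite /= lf.
by move=> z; apply: (@continuous_comp _ _ _ snd f); [exact: cvg_snd|exact: cf].
Qed.

Lemma Ck_on_cst n E F (U : set E) (a : F) : Ck_on n U (cst a).
Proof.
elim: n E F U a => [|n IH] E F U a; first by move=> x _; exact: cst_continuous.
split=> [x _|]; first exact: differentiable_cst.
have -> : (fun z : E * E => 'd (cst a) (z.1) z.2) = cst (0 : F).
  by apply/funext => z; rewrite diff_cst.
exact: IH.
Qed.

Lemma Ck_on_pair n E F G (U : set E) (f : E -> F) (g : E -> G) : open U ->
  Ck_on n U f -> Ck_on n U g -> Ck_on n U (fun x => (f x, g x)).
Proof.
elim: n E F G U f g => [|n IH] E F G U f g oU.
  by move=> cf cg x Ux; apply: cvg_pair; [exact: cf|exact: cg].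
move=> [df Cf] [dg Cg]; split=> [x Ux|].
  by apply: differentiable_pair; [exact: df|exact: dg].
have oUE : open (U `*` [set: E]) by exact: open_setXT.
apply: Ck_on_eq (IH _ _ _ _ _ _ oUE Cf Cg) => //.
move=> [x v]; rewrite inE => -[/= Ux _].
by rewrite (diff_pair (df x Ux) (dg x Ux)).
Qed.

(** By the chain rule the derivative map of the composite is that of [g] after the tangent map (x,
    v) |-> (f x, 'd f x v). The induction hypothesis serves twice: for the component [f] of the
    tangent map, and for this composition. *)
Lemma Ck_on_comp n E F G (U : set E) (V : set F) (f : E -> F) (g : F -> G) :
  open U -> (forall x, U x -> V (f x)) ->
  Ck_on n U f -> Ck_on n V g -> Ck_on n U (g \o f).
Proof.
elim: n E F G U V f g => [|n IH] E F G U V f g oU fUV.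
  move=> cf cg x Ux; apply: continuous_comp; first exact: cf.
  exact: cg (fUV x Ux).
move=> Cf [dg Cg]; have Cf' := Ck_onW Cf; move: Cf => [df Cf].
split=> [x Ux|].
  by apply: differentiable_comp; [exact: df|exact: dg (fUV x Ux)].
have oUE : open (U `*` [set: E]) by exact: open_setXT.
have Cp : Ck_on n (U `*` [set: E])
    (fun z : E * E => (f z.1, 'd f (z.1) z.2)).
  apply: Ck_on_pair => //; apply: (IH _ _ _ _ U fst f) => //.
    by move=> x [].
  by apply: Ck_on_linear => [//|z]; exact: cvg_fst.
have fUV' z : (U `*` [set: E]) z ->
    (V `*` [set: F]) (f z.1, 'd f (z.1) z.2).
  by move=> [Uz _]; split=> //; exact: fUV.
apply: Ck_on_eq (IH _ _ _ _ _ _ _ oUE fUV' Cp Cg) => //.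
move=> [x v]; rewrite inE => -[/= Ux _].
by rewrite (diff_comp (df x Ux) (dg _ (fUV x Ux))).
Qed.

Lemma Ck_onD n E F (U : set E) (f g : E -> F) : open U ->
  Ck_on n U f -> Ck_on n U g -> Ck_on n U (fun x => f x + g x).
Proof.
move=> oU Cf Cg.
apply: (@Ck_on_comp n _ _ _ U setT (fun x => (f x, g x)) (fun p => p.1 + p.2)) => //.
  exact: Ck_on_pair.
apply: Ck_on_linear => [a x y|]; last exact: add_continuous.
by rewrite /= scalerDr addrACA.
Qed.

Lemma Ck_on_bilinear n E F G (b : E -> F -> G) (U : set (E * F)) :
  (forall y, linear (b^~ y)) -> (forall x, linear (b x)) ->
  continuous (fun p : E * F => b p.1 p.2) ->
  Ck_on n U (fun p => b p.1 p.2).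
Proof.
move=> bl br bc; apply: (@Ck_on_subset _ _ _ _ setT) => //.
pose bL : {bilinear E -> F -> G} :=
  HB.pack b (bilinear_isBilinear.Build R E F G _ _ b (bl, br)).
elim: n => [|n IH]; first by move=> x _; exact: bc.
split=> [x _|]; first exact: (@differentiable_bilin _ _ _ _ bL).
(* The product rule expresses the derivative by [b] itself, precomposed with continuous linear maps;
   hence the earlier passage to the whole space. *)
have -> : (fun z : (E * F) * (E * F) => 'd (fun p : E * F => b p.1 p.2) (z.1) z.2) =
   (fun z : (E * F) * (E * F) => b z.1.1 z.2.2 + b z.2.1 z.1.2).
  by apply/funext => z; rewrite (@diff_bilin _ _ _ _ bL).
have oT : open ([set: E * F] `*` [set: E * F]) by exact/open_setXT/openT.
have c1 (V W : normedModType R) : continuous (fst : V * W -> V) by move=> z; exact: cvg_fst.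
have c2 (V W : normedModType R) : continuous (snd : V * W -> W) by move=> z; exact: cvg_snd.
apply: Ck_onD => //.
  apply: (@Ck_on_comp n _ _ _ _ setT (fun z => (z.1.1, z.2.2)) _ _ _ _ IH) => //.
  apply: Ck_on_linear => // z; apply: cvg_pair => /=.
    exact: (continuous_comp (c1 _ _ z) (c1 _ _ z.1)).
  exact: (continuous_comp (c2 _ _ z) (c2 _ _ z.2)).
apply: (@Ck_on_comp n _ _ _ _ setT (fun z => (z.2.1, z.1.2)) _ _ _ _ IH) => //.
apply: Ck_on_linear => // z; apply: cvg_pair => /=.
  exact: (continuous_comp (c2 _ _ z) (c1 _ _ z.2)).
exact: (continuous_comp (c1 _ _ z) (c2 _ _ z.1)).
Qed.

Lemma Ck_onZ n E F (U : set E) (f : E -> R^o) (g : E -> F) : open U ->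
  Ck_on n U f -> Ck_on n U g -> Ck_on n U (fun x => f x *: g x).
Proof.
move=> oU Cf Cg.
apply: (@Ck_on_comp n _ _ _ U setT (fun x => (f x, g x))
  (fun p : R^o * F => p.1 *: p.2)) => //.
  exact: Ck_on_pair.
apply: (@Ck_on_bilinear n R^o F F (fun a x => a *: x)).
- by move=> y a b c; rewrite /= scalerDl scalerA.
- by move=> y a b c; rewrite /= scalerDr !scalerA mulrC.
- exact: scale_continuous.
Qed.

End CkCalculus.

(** * Smoothness of exp (- 1 / s) extended by zero *)

Section FlatFunctions.
Variable R : realType.

Lemma is_diff0_quadratic (V W : normedModType R) (f : V -> W) (C : R) :
  f 0 = 0 -> 0 <= C -> (forall h, `|f h| <= C * `|h| ^+ 2) ->
  is_diff (0 : V) f \0.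
Proof.
move=> f0 C0 fC.
have ef : f \o shift 0 = cst (f 0) + \0 +o_ 0 id.
  (* [C] may be zero, so the radius is [e] divided by [C + 1]. *)
  have C1 : 0 < C + 1 by rewrite ltr_wpDl.
  apply/eqaddoP => e e0.
  have d0 : 0 < (C + 1)^-1 * e by apply: mulr_gt0; rewrite ?invr_gt0.
  have : \forall h \near (0 : V), `|h| <= (C + 1)^-1 * e.
    by apply/nbhs_norm0P; exists ((C + 1)^-1 * e) => //= h /ltW.
  apply: filterS => h; rewrite ler_pdivlMl// => Ch.
  rewrite !fctE /= addr0 f0 add0r subr0 (le_trans (fC h))// expr2 mulrA.
  by rewrite ler_wpM2r// (le_trans _ Ch)// ler_wpM2r// lerDl.
have dE : 'd f (0 : V) = \0 :> (V -> W).
  by apply: diff_unique => //; exact: cst_continuous.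
apply: DiffDef => //; apply/diff_locallyP; rewrite dE; split => //.
exact: cst_continuous.
Qed.

(** The factor 1 / s^k is there because differentiating exp (- 1 / s) produces such factors: the
    linear span of the family over all [k] is stable under differentiation. *)
Definition flat (k : nat) (s : R) : R :=
  if 0 < s then s^-1 ^+ k * expR (- s^-1) else 0.

(** For y = 1 / s > 0, the term of degree k + 2 of the exponential series gives y^(k+2) <= (k+2)!
    exp y. The quadratic bound makes the derivative at 0 vanish. *)
Lemma flat_le k s : `|flat k s| <= (k.+2)`!%:R * `|s| ^+ 2.
Proof.
rewrite /flat; case: ifPn => [s0|_]; last by rewrite normr0 mulr_ge0.
have y0 : 0 < s^-1 by rewrite invr_gt0.
have F0 : 0 < (k.+2)`!%:R :> R by rewrite ltr0n fact_gt0.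
have h : s^-1 ^+ k.+2 <= k.+2`!%:R * expR s^-1.
  rewrite mulrC -ler_pdivrMr// (le_trans _ (expR_ge1Dxn k.+1 (ltW y0)))//.
  by rewrite lerDr.
have : s^-1 ^+ k * expR (- s^-1) <= k.+2`!%:R * s ^+ 2.
  rewrite expRN ler_pdivrMr ?expR_gt0// mulrAC -ler_pdivrMr ?exprn_gt0//.
  by rewrite -exprVn -exprD addn2.
rewrite (ger0_norm (ltW s0)) ger0_norm//.
by rewrite mulr_ge0 ?exprn_ge0 ?expR_ge0 ?ltW.
Qed.

Lemma is_diff_flat k x :
  is_diff x (flat k) (fun h : R => h *: (flat k.+2 x - k%:R * flat k.+1 x)).
Proof.
have [x0|x0|->] := ltgtP x 0.
- have xf : \forall y \near x, cst (0 : R^o) y = flat k y.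
    near=> y; rewrite /flat lt_gtF//; near: y; exact: lt_nbhsl.
  have [d dE] := near_eq_is_diff xf (differentiable_cst _ _).
  apply: DiffDef => //; rewrite dE diff_cst; apply/funext => h.
  by rewrite /flat !(lt_gtF x0) mulr0 subr0 scaler0.
- pose f (s : R) : R := s^-1 ^+ k * expR (- s^-1).
  have xn0 : x != 0 by rewrite gt_eqF.
  have xf : \forall y \near x, f y = flat k y.
    near=> y; rewrite /flat ifT//; near: y; exact: lt_nbhsr.
  have dV : is_derive x 1 (fun s : R => s^-1) (- x ^- 2).
    apply: is_derive_eq; first exact: (@is_deriveV R id x 1 1).
    by rewrite [_ *: _]mulr1.
  have df : is_derive x 1 f (flat k.+2 x - k%:R * flat k.+1 x).
    have dE := @is_derive1_comp _ expR (- (fun s : R => s^-1)) x _ _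
      (is_derive_expR (- x^-1)) (is_deriveN dV).
    have := is_deriveM (is_deriveX k dV) dE.
    have -> : (fun s : R => s^-1) ^+ k * (expR \o - (fun s : R => s^-1)) = f.
      by apply/funext => s; rewrite /f !fctE.
    move=> {dE} dE; apply: is_derive_eq dE _.
    rewrite /flat x0 !fctE.
    rewrite -exprVn /GRing.scale /=.
    (* The power rule involves the exponent k - 1, hence the separate case k = 0. *)
    by case: (k) => [|j]; rewrite /= ?expr0 !exprS; ring.
  have fdiff : differentiable f x by apply/derivable1_diffP.
  have [d dE] := near_eq_is_diff xf fdiff.
  apply: DiffDef => //; rewrite dE diff1E//; apply/funext => h.
  by rewrite derive1E derive_val.
- have f0 j : flat j 0 = 0 by rewrite /flat ltxx.
  have [d dE] := @is_diff0_quadratic R^o R^o _ _ (f0 k) (ler0n _ _) (flat_le k).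
  apply: DiffDef => //; rewrite dE; apply/funext => h.
  by rewrite !f0 mulr0 subr0 scaler0.
Unshelve. all: by end_near. Qed.

(** Induction on [n] for all [k] at once, since the derivative involves the indices k + 1 and k +
    2. *)
Lemma Ck_on_flat n k : Ck_on n [set: R^o] (flat k).
Proof.
elim: n k => [|n IH] k.
  move=> x _; apply: differentiable_continuous.
  by have [] := is_diff_flat k x.
split=> [x _|]; first by have [] := is_diff_flat k x.
have -> : (fun z : R^o * R^o => 'd (flat k) (z.1) z.2) =
  (fun z : R^o * R^o => z.2 *: (flat k.+2 z.1 + (- k%:R : R) *: flat k.+1 z.1)).
  apply/funext => z; have [_ ->] := is_diff_flat k z.1.
  by rewrite scaleNr.
have oT : open ([set: R^o] `*` [set: R^o]) by exact/open_setXT/openT.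
have Cfst j : Ck_on n ([set: R^o] `*` [set: R^o]) (flat j \o fst).
  apply: (Ck_on_comp oT _ _ (IH j)) => //.
  by apply: Ck_on_linear => [//|z]; exact: cvg_fst.
apply: Ck_onZ => //.
  by apply: Ck_on_linear => [//|z]; exact: cvg_snd.
apply: Ck_onD => //; first exact: Cfst.
by apply: Ck_onZ => //; [exact: Ck_on_cst|exact: Cfst].
Qed.

End FlatFunctions.

(** * Bump functions from an equivalent Hilbert norm *)

Section HilbertBump.
Variables (R : realType) (E : completeNormedModType R).

(** For unit vectors, positivity of [b] at x + y and x - y bounds 2 |b x y| by b x x + b y y; the
    general case follows by homogeneity. *)
Lemma inner_product_bounded (b : E -> E -> R) (C : R) :
  inner_product b -> 0 < C -> (forall x, b x x <= C * `|x| ^+ 2) ->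
  forall x y, `|b x y| <= 2 * C * `|x| * `|y|.
Proof.
move=> ipb C0 bC.
pose bl z : {scalar E} := HB.pack (b^~ z) (GRing.isLinear.Build _ _ _ _ _ (ip_linear ipb z)).
have bZ a x y : b (a *: x) y = a * b x y by exact: (scalarZ (bl y)).
have bD x y z : b (x + y) z = b x z + b y z by exact: (raddfD (bl z)).
have b0 z : b 0 z = 0 by exact: (raddf0 (bl z)).
have bN x z : b (- x) z = - b x z by exact: (raddfN (bl z)).
have bpos x : 0 <= b x x.
  by have [->|/(ip_pos ipb)/ltW//] := eqVneq x 0; rewrite b0.
have unit_bound x y : `|x| = 1 -> `|y| = 1 -> `|b x y| <= 2 * C.
  move=> x1 y1.
  have := bpos (x + y); have := bpos (x - y).
  have := bC x; have := bC y; rewrite x1 y1 expr1n !bD !bN.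
  rewrite !(ip_sym ipb _ (x + y)) !(ip_sym ipb _ (x - y)) !bD !bN (ip_sym ipb y x).
  by rewrite ler_norml; move=> *; apply/andP; split; lra.
move=> x y; have [->|x0] := eqVneq x 0.
  by rewrite b0 !normr0 mulr0 mul0r.
have [->|y0] := eqVneq y 0.
  by rewrite (ip_sym ipb) b0 !normr0 mulr0.
have nx0 : 0 < `|x| by rewrite normr_gt0.
have ny0 : 0 < `|y| by rewrite normr_gt0.
have nu (z : E) : z != 0 -> `| `|z|^-1 *: z | = 1 :> R.
  by move=> z0; rewrite normrZ normfV normr_id mulVf ?normr_eq0.
have := unit_bound _ _ (nu _ x0) (nu _ y0).
rewrite bZ (ip_sym ipb) bZ (ip_sym ipb) !normrM !normfV !normr_id.
rewrite ler_pdivrMl// ler_pdivrMl// => h.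
by apply: le_trans h _; rewrite le_eqVlt; apply/orP; left; apply/eqP; ring.
Qed.

Lemma inner_product_continuous (b : E -> E -> R) (C : R) :
  inner_product b -> 0 < C -> (forall x, b x x <= C * `|x| ^+ 2) ->
  continuous (fun p : E * E => b p.1 p.2).
Proof.
move=> ipb C0 bC p.
have bb := inner_product_bounded ipb C0 bC.
have bBl x y z : b (x - y) z = b x z - b y z.
  pose bl : {scalar E} := HB.pack (b^~ z) (GRing.isLinear.Build _ _ _ _ _ (ip_linear ipb z)).
  exact: (raddfB bl).
apply/subr_cvg0; apply: norm_cvg0.
(* This majorant comes from changing one argument of [b] at a time, with symmetry used in the second
   term. *)
pose h (q : E * E) : R := 2 * C * (`|q.1 - p.1| * `|q.2| + `|q.2 - p.2| * `|p.1|).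
apply: (@squeeze_cvgr _ _ _ _ (cst 0) h).
- near=> q; rewrite normr_ge0 /= /h.
  have -> : b q.1 q.2 - b p.1 p.2 = b (q.1 - p.1) q.2 + b (q.2 - p.2) p.1.
    by rewrite !bBl !(ip_sym ipb _ p.1); ring.
  by rewrite (le_trans (ler_normD _ _))// mulrDr !mulrA lerD.
- exact: cvg_cst.
- have -> : 0 = 2 * C * (`|p.1 - p.1| * `|p.2| + `|p.2 - p.2| * `|p.1|) :> R.
    by rewrite !subrr normr0; ring.
  have c1 : q.1 @[q --> p] --> p.1 by exact: cvg_fst.
  have c2 : q.2 @[q --> p] --> p.2 by exact: cvg_snd.
  apply: cvgM; first exact: cvg_cst.
  apply: cvgD; apply: cvgM; try exact: cvg_cst; apply: cvg_norm => //;
    by apply: cvgB => //; exact: cvg_cst.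
Unshelve. all: by end_near. Qed.

Lemma smooth_bump (x0 : E) (r : R) : hilbertable E -> 0 < r ->
  exists phi : E -> R^o, [/\ smooth_on [set: E] phi, phi x0 = 1 &
    forall x, phi x != 0 -> ball x0 r x].
Proof.
move=> [b [ipb [c [C [c0 C0 bcC]]]]] r0.
pose bl z : {scalar E} := HB.pack (b^~ z) (GRing.isLinear.Build _ _ _ _ _ (ip_linear ipb z)).
have bcont : continuous (fun p : E * E => b p.1 p.2).
  by apply: (inner_product_continuous ipb C0) => x; have /andP[] := bcC x.
pose q (x : E) : R^o := b (x - x0) (x - x0).
have sq : smooth_on [set: E] q.
  move=> n; have CB : Ck_on n [set: E] (fun x => x - x0).
    apply: Ck_onD => //; [exact: openT| |exact: Ck_on_cst].
    by apply: Ck_on_linear => // z.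
  apply: (@Ck_on_comp R n E (E * E)%type R^o setT setT
     (fun x => (x - x0, x - x0)) (fun p => b p.1 p.2)) => //.
  - exact: openT.
  - by apply: Ck_on_pair => //; exact: openT.
  - apply: (@Ck_on_bilinear R n E E R^o b) => // z a x y; first exact: ip_linear.
    by rewrite !(ip_sym ipb z); exact: ip_linear.
(* With this threshold, [q x < d] and the lower bound c |x - x0|^2 <= q x give |x - x0| < r. The
   bump is [flat 0] at 1 - q / d, which vanishes once q >= d; the factor [e] normalizes its value at
   [x0]. *)
pose d := c * r ^+ 2.
have d0 : 0 < d by rewrite mulr_gt0 ?exprn_gt0.
pose e := (flat 0 (1 : R))^-1.
have e0 : flat 0 (1 : R) != 0.
  by rewrite /flat ltr01 expr0 mul1r gt_eqF ?expR_gt0.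
exists (fun x => e *: (flat 0 (1 + (- d^-1) *: q x : R) : R^o)); split.
- move=> n; apply: Ck_onZ; [exact: openT|exact: Ck_on_cst|].
  apply: (@Ck_on_comp R n E R^o R^o setT setT
    (fun x => 1 + (- d^-1) *: q x) (flat 0)) => //; first exact: openT.
    apply: Ck_onD; [exact: openT|exact: Ck_on_cst|].
    by apply: Ck_onZ; [exact: openT|exact: Ck_on_cst|exact: sq].
  exact: Ck_on_flat.
- have -> : q x0 = 0 by rewrite /q subrr; exact: (raddf0 (bl 0)).
  by rewrite scaler0 addr0; exact: mulVf.
- move=> x; rewrite -ball_normE /= distrC /flat.
  case: ifPn => [|_]; last by rewrite scaler0 eqxx.
  rewrite scaleNr subr_gt0 => qd _.
  have {qd} qd : q x < d by move: qd; rewrite /GRing.scale /= ltr_pdivrMl// mulr1.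
  have /andP[h _] := bcC (x - x0).
  have := le_lt_trans h qd.
  by rewrite /d ltr_pM2l// ltr_pXn2r// nnegrE// ltW.
Qed.

End HilbertBump.

(** * Charts, transition maps and extension of tangent vectors *)

Section TangentExtension.
Variables (R : realType) (E : completeNormedModType R) (M : manifold E).
Implicit Types (c : chart E M) (u : M).

Lemma ch_invK c x : ch_cod c x -> c (ch_inv c x) = x.
Proof. by move=> [u cu <-]; rewrite ch_funK. Qed.

Lemma ch_inv_dom c x : ch_cod c x -> ch_dom c (ch_inv c x).
Proof. by move=> [u cu <-]; rewrite ch_funK. Qed.

Lemma open_chart_image c (O : set M) : open O ->
  open (c @` (ch_dom c `&` O)).
Proof.
move=> oO; have -> : c @` (ch_dom c `&` O) = ch_cod c `&` ch_inv c @^-1` O.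
  apply/seteqP; split=> [_ [u [cu Ou] <-]|x [cx Ox]].
    by split; [exists u|rewrite /preimage /= ch_funK].
  exists (ch_inv c x); last exact: ch_invK.
  by split=> //; exact: ch_inv_dom.
rewrite openE => x [cx Ox]; apply: filterI.
  by apply: open_nbhs_nbhs; split=> //; exact: ch_cod_open.
apply: (ch_inv_continuous cx); exact: open_nbhs_nbhs.
Qed.

Lemma near_chart_image c (O : set M) u : open O -> ch_dom c u -> O u ->
  \forall x \near c u, ch_cod c x /\ O (ch_inv c x).
Proof.
move=> oO cu Ou.
have : nbhs (c u) (c @` (ch_dom c `&` O)).
  by apply: open_nbhs_nbhs; split; [exact: open_chart_image|exists u].
by apply: filterS => _ [z [cz Oz] <-]; rewrite ch_funK//; split=> //; exists z.
Qed.

Lemma differentiable_transition c c' u : atlas c -> atlas c' ->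
  ch_dom c u -> ch_dom c' u -> differentiable (c' \o ch_inv c) (c u).
Proof.
move=> ac ac' cu c'u; have [+ _] := atlas_compatible ac ac' 1.
by apply; exists u.
Qed.

(** The chain rule for transition maps, whose composite equals c o a^-1 only near [a u]. It removes
    the auxiliary chart [chart_at u] from coordinate computations. *)
Lemma diff_transition_comp a b c u (v : E) :
  atlas a -> atlas b -> atlas c -> ch_dom a u -> ch_dom b u -> ch_dom c u ->
  'd (c \o ch_inv b) (b u) ('d (b \o ch_inv a) (a u) v)
  = 'd (c \o ch_inv a) (a u) v.
Proof.
move=> aa ab ac au bu cu.
have dba := differentiable_transition aa ab au bu.
have buE : (b \o ch_inv a) (a u) = b u by rewrite /= ch_funK.
have dcb : differentiable (c \o ch_inv b) ((b \o ch_inv a) (a u)).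
  by rewrite buE; exact: differentiable_transition.
have eqn : \forall x \near a u,
    ((c \o ch_inv b) \o (b \o ch_inv a)) x = (c \o ch_inv a) x.
  apply: filterS (near_chart_image (ch_dom_open b) au bu) => x [_ bx] /=.
  by rewrite ch_funK.
have [_ dE] := near_eq_is_diff eqn (differentiable_comp dba dcb).
have := congr1 (@^~ v) (etrans dE (diff_comp dba dcb)).
by rewrite /= ch_funK.
Qed.

Lemma diff_chart_id c u (v : E) : ch_dom c u ->
  'd (c \o ch_inv c) (c u) v = v.
Proof.
move=> cu; have eqn : \forall x \near c u, id x = (c \o ch_inv c) x.
  apply: filterS (near_chart_image openT cu I) => x [cx _] /=.
  by rewrite ch_invK.
have [dd dE] : is_diff (c u) (@id E) id by exact: is_diff_id.
by have [_ ->] := near_eq_is_diff eqn dd; rewrite dE.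
Qed.

(* The vector is extended by a constant field in a chart and then cut off;
   regularity of M makes the cut-off field vanish near the boundary of the
   domain of the chart. *)
Lemma smooth_field_extension (w : M) (v : Tan w) :
  exists X : forall u : M, Tan u, smooth_field X /\ X w = v.
Proof.
pose c0 := chart_at w.
have c0w : ch_dom c0 w := mem_chart_at w.
have ac0 : atlas c0 := atlas_chart_at w.
have [W nW Wc0] : filter_from (nbhs w) closure (ch_dom c0).
  have nc0 : nbhs w (ch_dom c0).
    by apply: open_nbhs_nbhs; split => //; exact: ch_dom_open.
  exact: (@carrier_regular _ _ M w _ nc0).
have [r r0 rW] : exists2 r : R, 0 < r & ball (c0 w) r `<=` ch_inv c0 @^-1` W.
  apply/nbhs_ballP; apply: (ch_inv_continuous (c := c0)); first by exists w.
  by rewrite ch_funK.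
have [phi [sphi phi1 phi0]] := smooth_bump (c0 w) (model_hilbertable M) r0.
pose X u : Tan u :=
  if `[< ch_dom c0 u >] then phi (c0 u) *: of_chart c0 u v else 0.
exists X; split; last first.
  by rewrite /X asboolT// phi1 scale1r /of_chart diff_chart_id.
move=> c ac n.
(* On [A] the field has its explicit expression through [c0]; on [B] it is zero. These open sets
   cover the chart image because closure W lies in the domain of [c0]. *)
pose A := c @` (ch_dom c `&` ch_dom c0).
pose B := c @` (ch_dom c `&` ~` closure W).
have oA : open A by apply: open_chart_image; exact: ch_dom_open.
have oB : open B.
  by apply: open_chart_image; apply: closed_openC; exact: closed_closure.
have AB : ch_cod c `<=` A `|` B.
  move=> _ [u cu <-]; have [c0u|nc0u] := pselect (ch_dom c0 u).
    by left; exists u.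
  by right; exists u => //; split=> // /Wc0.
apply: (Ck_on_subset AB); apply: Ck_onU.
  have tau : Ck_on n A (c0 \o ch_inv c) by exact: atlas_compatible.
  pose D := c0 @` (ch_dom c0 `&` ch_dom c).
  (* The components of the field involve the differential of a transition map, so order n + 1 of
     compatibility is spent here. *)
  have dsigma : Ck_on n (D `*` [set: E])
      (fun z => 'd (c \o ch_inv c0) (z.1) z.2).
    by have [_] := atlas_compatible ac0 ac n.+1.
  have F : Ck_on n A (fun x => phi ((c0 \o ch_inv c) x) *:
      'd (c \o ch_inv c0) ((c0 \o ch_inv c) x) v).
    apply: Ck_onZ => //; first exact: (Ck_on_comp oA (V := setT) _ tau (sphi n)).
    apply: (Ck_on_comp oA (f := fun x => ((c0 \o ch_inv c) x, v)) _ _ dsigma).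
      move=> _ [u [cu c0u] <-]; split=> //=; rewrite ch_funK//.
      by exists u.
    by apply: Ck_on_pair => //; exact: Ck_on_cst.
  apply: Ck_on_eq F => // x; rewrite inE => -[u [cu c0u] <-] /=.
  rewrite ch_funK// /X asboolT// /to_chart linearZ /=; congr (_ *: _).
  rewrite /of_chart diff_transition_comp//; first exact: atlas_chart_at.
  exact: mem_chart_at.
apply: (Ck_on_eq oB _ (Ck_on_cst n B 0)) => x.
rewrite inE => -[u [cu Wu] <-] /=; rewrite ch_funK// /X.
have -> : (if `[< ch_dom c0 u >] then phi (c0 u) *: of_chart c0 u v else 0) = 0.
  (* A nonzero bump at [c0 u] would put [u] in W, against the choice of [B]. *)
  case: asboolP => // c0u; have [->|/phi0/rW] := eqVneq (phi (c0 u)) 0.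
    by rewrite scale0r.
  by rewrite /preimage /= ch_funK// => Wu'; case: Wu; exact: subset_closure.
by rewrite /to_chart linear0.
Qed.

End TangentExtension.

(** * Hyperbolicity of the reduced system *)

Theorem theorem2 (R : realType) (E Eh : completeNormedModType R)
    (M : manifold E) (Mh : manifold Eh) (g : form_field M)
    (d : nat) (S : first_order_system M d) (i : Mh -> M) (p : M -> Mh)
    (g_riemannian : riemannian_metric g)
    (A_dense : forall j, densely_defined (flux S j))
    (i_embedding : embedding i)
    (p_smooth : smooth_map p)
    (p_retraction : cancel i p)
    (A_reducible : forall j, reducible i p (flux S j))
    (ip_adjoint : adjoint_push i p g) :
  hyperbolic g S -> hyperbolic (pullback i g) (reduced_system i p S).
Proof.
move=> hyp X Y sX sY j u domX domY.
have gC : forall x y : Tan (i u), g (i u) x y = g (i u) y x.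
  by move=> x y; apply: ip_sym; exact: (g_riemannian.1 (i u)).
have [X' [sX' X'E]] := smooth_field_extension (tangent_map i (X u)).
have [Y' [sY' Y'E]] := smooth_field_extension (tangent_map i (Y u)).
(* Adjointness for a single vector [V] at [i u], needed because A i_* X is known only there. *)
have push (Z : forall w : Mh, Tan w) (V : Tan (i u)) : smooth_field Z ->
    pullback i g (retract_push p V) (Z u) = g (i u) V (tangent_map i (Z u)).
  move=> sZ; have [V' [sV' <-]] := smooth_field_extension V.
  exact: ip_adjoint.
have AS := hyp X' Y' sX' sY' j (i u).
rewrite X'E Y'E in AS.
(* Adjointness has p_* in the first slot, so the right-hand side is first swapped. The domain
   conditions of [AS] are those of the reduced operator, whose domain is the preimage under i_*. *)
rewrite [RHS]gC -[RHS]/(pullback i g _ _) /= /reduced_fun !push//.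
by rewrite AS// gC.
Qed.
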